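(* Let $n\ge1$, $\mathcal{M}=\{1^{k_1},\ldots,n^{k_n}\}$ with all $k_i\ge1$, and let $m\ge0$ be an integer. There is a bijection $\psi:\mathcal{BT}_{\mathcal{M},m}\to\mathcal{T}^*_{\mathcal{M},m}$.
   Context: $\mathcal{M}$ is the multiset in which $i$ occurs exactly $k_i$ times. An ordered tree is a rooted tree whose children at each vertex are linearly ordered left to right; the level of a vertex is its distance from the root. Vertices compare by their labels. $\mathcal{T}_{\mathcal{M}}$: ordered trees with vertices labeled by the multiset $\{0\}\cup\mathcal{M}$ (each label used exactly as often as its multiplicity), root labeled $0$, and each odd-level vertex labeled $i$ having exactly $k_i-1$ children, all labeled $i$. A half-edge is an edge whose lower endpoint is an unlabeled leaf. $\mathcal{T}^*_{\mathcal{M},m}$ is the set of trees obtained from some $T\in\mathcal{T}_{\mathcal{M}}$ by attaching, in total, $m$ half-edges to vertices at even level of $T$ (interleaved among their children), such that for each even-level vertex $u$: (1) the half-edges at $u$, viewed as walls, divide the labeled children of $u$ into (possibly empty) compartments, and within each compartment the labeled children increase from left to right; (2) if the last labeled child $v$ of $u$ satisfies $v>u$, some half-edge lies to the right of $v$; (3) if the first labeled child $v$ of $u$ satisfies $u>v$, some half-edge lies to the left of $v$. $\mathcal{BT}_{\mathcal{M},m}$ is the set of ordered trees such that: (i) vertices are labeled by the multiset $\{0\}\cup\mathcal{M}$ (each label used exactly as often as its multiplicity), except that some leaves at odd level may be unlabeled; (ii) the root is labeled $0$; (iii) each labeled odd-level vertex with label $i$ has exactly $k_i-1$ children, all labeled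 $i$; (iv) for each internal vertex $v$ at even level, the sequence of children of $v$ is divided into consecutive blocks, each block being either a single unlabeled leaf or a nonempty set of labeled children increasing from left to right; and the total number of blocks (over all even-level internal vertices) is $m$. *)

(* Defs.v *)
From mathcomp Require Import all_boot.

Set Implicit Arguments.
Unset Strict Implicit.
Unset Printing Implicit Defensive.

(* Ordered trees.  [Blank] is an unlabeled leaf; every other vertex carries a
   datum in [D].  For plain trees [D] is [nat] (the label); for trees with
   divided child sequences see [BT] below. *)
Inductive otree (D : Type) : Type :=
  | Blank
  | Vertex of D & seq (otree D).

Arguments Blank {D}.

Section Trees.
Variable D : Type.
Implicit Type t : otree D.

Definition label t : option D := if t is Vertex d _ then Some d else None.

Definition labeled t : bool := isSome (label t).

(* All vertices of [t], in preorder, each given as the pair of its level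
   (the root of [t] being at level [l]) and the subtree hanging from it. *)
Fixpoint vertices (l : nat) t : seq (nat * otree D) :=
  (l, t) ::
  (if t is Vertex _ cs then flatten [seq vertices l.+1 c | c <- cs] else [::]).

Definition labels t : seq D := pmap (fun v => label v.2) (vertices 0 t).

(* Unlabeled vertices occur only at odd level. *)
Definition blanks_at_odd_level t : bool :=
  all (fun v => labeled v.2 || odd v.1) (vertices 0 t).

Definition num_blanks t : nat :=
  count (fun v => ~~ labeled v.2) (vertices 0 t).

End Trees.

Fixpoint map_otree (D E : Type) (f : D -> E) (t : otree D) : otree E :=
  if t is Vertex d cs then Vertex (f d) [seq map_otree f c | c <- cs]
  else Blank.

(* The multiset {1^(k 1), ..., n^(k n)}, as a sequence up to permutation. *)
Definition multiset (n : nat) (k : nat -> nat) : seq nat :=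
  flatten [seq nseq (k i) i | i <- iota 1 n].

Definition labeled_by (n : nat) (k : nat -> nat) (t : otree nat) : bool :=
  perm_eq (labels t) (0 :: multiset n k).

Definition odd_level_rule (k : nat -> nat) (t : otree nat) : bool :=
  all (fun v => if v.2 is Vertex i cs then
                  odd v.1 ==> (size cs == k i - 1)
                              && all (fun c => label c == Some i) cs
                else true)
      (vertices 0 t).

Definition T (n : nat) (k : nat -> nat) (t : otree nat) : bool :=
  [&& all (fun v => labeled v.2) (vertices 0 t), labeled_by n k t,
      label t == Some 0 & odd_level_rule k t].

(* Deletes all half-edges, i.e. recovers the tree they were attached to. *)
Fixpoint strip (t : otree nat) : otree nat :=
  if t is Vertex i cs then Vertex i [seq c <- map strip cs | labeled c]
  else Blank.

(* In the next three definitions a child sequence is represented by its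
   sequence of labels, a half-edge being [None]. *)

(* The maximal runs between walls; [h] half-edges yield [h.+1] runs. *)
Fixpoint compartments (s : seq (option nat)) : seq (seq nat) :=
  match s with
  | [::] => [:: [::]]
  | None :: s' => [::] :: compartments s'
  | Some i :: s' =>
      (i :: head [::] (compartments s')) :: behead (compartments s')
  end.

(* If the first labeled child satisfies [P], a half-edge precedes it. *)
Definition wall_before_first (P : pred nat) (s : seq (option nat)) : bool :=
  let j := find isSome s in
  if nth None s j is Some v then P v ==> (None \in take j s) else true.

(* Reversing the sequence turns "first" into "last" and "left" into "right". *)
Definition wall_rule (u : nat) (s : seq (option nat)) : bool :=
  [&& all (sorted ltn) (compartments s),
      wall_before_first (fun v => u < v) (rev s)
    & wall_before_first (fun v => v < u) s].

Definition Tstar (n : nat) (k : nat -> nat) (m : nat) (t : otree nat) : bool :=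
  [&& T n k (strip t), blanks_at_odd_level t, num_blanks t == m
    & all (fun v => if v.2 is Vertex u cs then
                      ~~ odd v.1 ==> wall_rule u (map (@label nat) cs)
                    else true)
          (vertices 0 t)].

(* The division of child sequences into blocks is part of the structure: each
   labeled vertex carries its label together with the list of the sizes of the
   consecutive blocks of its children.  At odd level, where nothing is
   divided, this list is required to be empty. *)
Definition divided_tree : Type := otree (nat * seq nat).

Definition underlying : divided_tree -> otree nat := map_otree fst.

Definition block_sizes (t : divided_tree) : seq nat :=
  if t is Vertex d _ then d.2 else [::].

(* [s] is the sequence of labels of the children in the block. *)
Definition is_block (s : seq (option nat)) : bool :=
  (s == [:: None])
  || [&& s != [::], all isSome s & sorted ltn (pmap id s)].

(* The size equation makes [reshape] cut the whole sequence exactly. *)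
Definition divided_into_blocks (sz : seq nat) (s : seq (option nat)) : bool :=
  (sumn sz == size s) && all is_block (reshape sz s).

Definition BT (n : nat) (k : nat -> nat) (m : nat) (t : divided_tree) : bool :=
  [&& labeled_by n k (underlying t), blanks_at_odd_level (underlying t),
      label (underlying t) == Some 0, odd_level_rule k (underlying t),
      all (fun v => if v.2 is Vertex d cs then
                      if odd v.1 then d.2 == [::]
                      else divided_into_blocks d.2
                             [seq label (underlying c) | c <- cs]
                    else true)
          (vertices 0 t)
    & sumn [seq size (block_sizes v.2) | v <- vertices 0 t & ~~ odd v.1] == m].

(* Main.v *)
(* The bijection acts independently at each even-level vertex [u].  A block [b]
   of children splits as L ++ G, where L collects the labels below [u] and G
   those above; it is replaced by G, a half-edge, then L.  A blank block becomes
   a bare half-edge, so blocks and half-edges are equinumerous.  Between two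
   consecutive half-edges the labels read L_j ++ G_(j+1), which is increasing;
   the first compartment is G_0 and the last is L_r, which are exactly the two
   boundary conditions.  Conversely, block [j] is recovered as the part of
   compartment [j+1] below [u] followed by the part of compartment [j] above.
   For this no child of [u] may be labeled [u], which is where the
   multiplicities [k i] are used. *)

Require Import Defs.
From HB Require Import structures.
From mathcomp Require Import all_boot.
From mathcomp Require Import zify ring.

Set Implicit Arguments.
Unset Strict Implicit.
Unset Printing Implicit Defensive.

Lemma all_flatten (A : Type) (P : pred A) (ss : seq (seq A)) :
  all P (flatten ss) = all (all P) ss.
Proof. by elim: ss => //= s ss <-; rewrite all_cat. Qed.

Lemma all_last (A : Type) (P : pred A) x (s : seq A) :
  all P (x :: s) -> P (last x s).
Proof. by elim: s x => /= [|y s IH] x /andP[Px Ps] //; apply: IH. Qed.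

(** * Blocks and walls at one vertex *)

Section BlocksAndWalls.
(* [key] is the label of a child; [blank] is the unlabeled leaf, serving both as
   blank block and as wall. *)
Variables (A : Type) (key : A -> option nat) (blank : A) (u : nat).
Hypothesis key_blank : key blank = None.
Hypothesis blank_key : forall x, key x = None -> x = blank.
Implicit Types (x : A) (b C s : seq A) (bs Cs : seq (seq A)).

Definition below x := if key x is Some v then v < u else false.
Definition above x := if key x is Some v then u < v else false.
Definition keyed x : bool := key x.
(** The pairwise form passes to subsequences and bounds all later keys by the first one; a blank
    contributes no key. *)
Definition increasing b := pairwise ltn (pmap key b).
Definition avoiding b := all (fun x => key x != Some u) b.

Definition wall_block b := filter above b ++ blank :: filter below b.
Definition walls_of_blocks bs := flatten [seq wall_block b | b <- bs].

(** The recursion of [compartments], keeping the children themselves rather than their labels. The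
    result is never empty, so the default of [head] is never reached. *)
Fixpoint runs s : seq (seq A) :=
  if s is x :: s' then
    if keyed x then (x :: head [::] (runs s')) :: behead (runs s')
    else [::] :: runs s'
  else [:: [::]].

Definition unruns C Cs := C ++ flatten [seq blank :: C' | C' <- Cs].

(** A block is never empty: a wall to which neither adjacent run contributes stands for a blank
    block. *)
Definition fill b := if nilp b then [:: blank] else b.
Definition merge_runs C C' := fill (filter below C' ++ filter above C).
(** Each wall separates two consecutive runs, so [pairmap] over the runs yields exactly one block
    per wall. *)
Definition blocks_of_walls s :=
  pairmap merge_runs (head [::] (runs s)) (behead (runs s)).

Lemma below_blank : below blank = false. Proof. by rewrite /below key_blank. Qed.
Lemma above_blank : above blank = false. Proof. by rewrite /above key_blank. Qed.
Lemma keyed_blank : keyed blank = false. Proof. by rewrite /keyed key_blank. Qed.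

Lemma filter_below_above b : filter below (filter above b) = [::].
Proof.
rewrite -filter_predI (@eq_filter _ _ pred0) ?filter_pred0 // => x /=.
by rewrite /below /above; case: (key x) => // v; case: ltngtP.
Qed.

Lemma filter_above_below b : filter above (filter below b) = [::].
Proof.
rewrite -filter_predI (@eq_filter _ _ pred0) ?filter_pred0 // => x /=.
by rewrite /below /above; case: (key x) => // v; case: ltngtP.
Qed.

Lemma all_keyed_below b : all keyed (filter below b).
Proof.
by elim: b => //= x b IH; case: ifP => //= ltx; rewrite IH andbT;
   move: ltx; rewrite /below /keyed; case: key.
Qed.

Lemma all_keyed_above b : all keyed (filter above b).
Proof.
by elim: b => //= x b IH; case: ifP => //= ltx; rewrite IH andbT;
   move: ltx; rewrite /above /keyed; case: key.
Qed.

(** * Cutting a child sequence into runs *)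

Lemma runs_cons s : runs s = head [::] (runs s) :: behead (runs s).
Proof. by case: s => //= x s; case: keyed. Qed.

Lemma runs_cat C s : all keyed C ->
  runs (C ++ s) = (C ++ head [::] (runs s)) :: behead (runs s).
Proof.
elim: C => [|x C IH] /=; first by rewrite -runs_cons.
by case/andP => kx /IH ->; rewrite kx.
Qed.

Lemma runsK s : unruns (head [::] (runs s)) (behead (runs s)) = s.
Proof.
rewrite /unruns; elim: s => //= x s IH; case: ifP => kx /=; first by rewrite IH.
rewrite runs_cons /= IH; congr cons.
by rewrite [RHS]blank_key //; move: kx; rewrite /keyed; case: key.
Qed.

Lemma all_keyed_runs s : all (all keyed) (runs s).
Proof.
elim: s => //= x s; rewrite runs_cons /= => /andP[kh kt].
by case: ifP => kx /=; rewrite ?kx kh.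
Qed.

Lemma compartments_runs s :
  compartments (map key s) = [seq pmap key C | C <- runs s].
Proof.
elim: s => //= x s ->; rewrite /keyed; case kx: (key x) => [v|] //=.
by rewrite runs_cons /= kx.
Qed.

(** The value [u] separates the two parts. This serves both directions: it orders the compartments
    made from consecutive blocks and the blocks recovered from consecutive compartments. *)
Lemma increasing_cat_below_above b b' : increasing b -> increasing b' ->
  increasing (filter below b ++ filter above b').
Proof.
have fb c : pmap key (filter below c) = filter (fun v => v < u) (pmap key c).
  by elim: c => //= x c IH; rewrite /below; case kx: (key x) => [v|] //=;
     case: ifP => //= _; rewrite kx /= -IH.
have fa c : pmap key (filter above c) = filter (fun v => u < v) (pmap key c).
  by elim: c => //= x c IH; rewrite /above; case kx: (key x) => [v|] //=;
     case: ifP => //= _; rewrite kx /= -IH.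
rewrite /increasing pmap_cat fb fa pairwise_cat => ib ib'.
rewrite !(subseq_pairwise (filter_subseq _ _)) // !andbT.
apply/allrelP => x y; rewrite !mem_filter => /andP[lx _] /andP[ly _].
exact: ltn_trans ly.
Qed.

(** In increasing order the keys below [u] come first, and as no key equals [u] the two filters lose
    nothing. *)
Lemma split_below_above b : all keyed b -> increasing b -> avoiding b ->
  filter below b ++ filter above b = b.
Proof.
rewrite /increasing; elim: b => //= x b IH /andP[kx kb].
move: kx; rewrite /keyed /below /above /=; case kx: (key x) => [v|] //= _.
case/andP=> vb ib /andP[nv nb]; have {}IH := IH kb ib nb.
case: ltngtP => [ltvu|ltuv|eqvu]; first by rewrite cat_cons IH.
  (* Once the first key exceeds [u], all later keys do. *)
  suff -> : filter above b = b.
    suff -> : filter below b = [::] by [].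
    elim: b vb {ib nb kb IH} => //= y b IH.
    rewrite /below; case: (key y) => [w|] //=; case/andP=> vw /IH ->.
    by rewrite ltnNge ltnW // (ltn_trans ltuv).
  elim: b vb kb {ib nb IH} => //= y b IH.
  rewrite /keyed /above; case: (key y) => [w|] //=; case/andP=> vw vb kb.
  by rewrite (ltn_trans ltuv vw) IH.
by move: nv; rewrite eqvu eqxx.
Qed.


Lemma pmap_id_keys b : pmap id (map key b) = pmap key b.
Proof. by elim: b => //= x b IH; case: (key x) => //= v; rewrite IH. Qed.

Lemma is_block_cases b : is_block (map key b) ->
  b = [:: blank] \/ [/\ ~~ nilp b, all keyed b & increasing b].
Proof.
case/orP => [/eqP|/and3P[nb kb ib]].
  by case: b => [|x [|y b]] //= [/blank_key->]; left.
right; split; first by case: b nb {kb ib}.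
  by move: kb; rewrite all_map.
by rewrite /increasing -(sorted_pairwise ltn_trans) -pmap_id_keys.
Qed.

Lemma is_block_fill b : all keyed b -> increasing b ->
  is_block (map key (fill b)).
Proof.
rewrite /fill /increasing /is_block -(sorted_pairwise ltn_trans) -pmap_id_keys.
case: b => [|x b] /= kb ib; first by rewrite key_blank.
by apply/orP; right; rewrite all_map; apply/andP.
Qed.

Lemma increasing_block b : is_block (map key b) -> increasing b.
Proof. by case/is_block_cases => [->|[]] //; rewrite /increasing /= key_blank. Qed.

Lemma fill_split_block b : is_block (map key b) -> avoiding b ->
  fill (filter below b ++ filter above b) = b.
Proof.
case/is_block_cases => [->|[nb kb ib]] av.
  by rewrite /= below_blank above_blank.
by rewrite split_below_above // /fill (negPf nb).
Qed.

Lemma filter_below_fill b : filter below (fill b) = filter below b.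
Proof. by case: b => //=; rewrite below_blank. Qed.

Lemma filter_above_fill b : filter above (fill b) = filter above b.
Proof. by case: b => //=; rewrite above_blank. Qed.

Lemma wall_block_merge C C' :
  wall_block (merge_runs C C') = filter above C ++ blank :: filter below C'.
Proof.
rewrite /wall_block filter_below_fill filter_above_fill !filter_cat.
by rewrite filter_above_below filter_below_above !filter_id cats0.
Qed.

(** The wall of [b] closes the run of its upper part, while its lower part flows into the first run
    of the remaining blocks. *)
Lemma runs_walls_of_blocks_cons b bs :
  runs (walls_of_blocks (b :: bs)) =
  filter above b :: (filter below b ++ head [::] (runs (walls_of_blocks bs)))
                 :: behead (runs (walls_of_blocks bs)).
Proof.
rewrite /walls_of_blocks /= /wall_block -catA runs_cat ?all_keyed_above //=.
by rewrite keyed_blank /= cats0 runs_cat ?all_keyed_below.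
Qed.

Lemma filter_below_head_walls bs :
  filter below (head [::] (runs (walls_of_blocks bs))) = [::].
Proof.
by case: bs => // b bs; rewrite runs_walls_of_blocks_cons /= filter_below_above.
Qed.

(** A run to the left of a wall enters the merge only through its part above [u]. *)
Lemma pairmap_merge_head C0 C Cs : filter above C0 = filter above C ->
  pairmap merge_runs C0 Cs = pairmap merge_runs C Cs.
Proof. by case: Cs => //= C' Cs; rewrite /merge_runs => ->. Qed.

Lemma walls_of_blocksK bs :
  all (fun b => is_block (map key b)) bs -> all avoiding bs ->
  blocks_of_walls (walls_of_blocks bs) = bs.
Proof.
elim: bs => //= b bs IH /andP[kb kbs] /andP[ab abs].
rewrite /blocks_of_walls runs_walls_of_blocks_cons /=; congr cons.
  rewrite /merge_runs filter_cat filter_below_head_walls cats0 !filter_id.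
  exact: fill_split_block.
(* For the later blocks, the lower part of [b] at the front of the run is invisible, so the run may
   be replaced by the first run of [walls_of_blocks bs]. *)
rewrite -[RHS]IH //; apply: pairmap_merge_head.
by rewrite filter_cat filter_above_below.
Qed.

(** * The wall rule read off the runs *)

Lemma wall_before_firstE P (s : seq (option nat)) :
  wall_before_first P s = if head None s is Some v then ~~ P v else true.
Proof.
rewrite /wall_before_first; case: s => [|[v|] s] //=.
(* A leading [None] already precedes the first label, so only a label in first position can violate
   the condition. *)
by case: nth => // v; case: (P v).
Qed.

Lemma head_runs s :
  head None (map key (head [::] (runs s))) = head None (map key s).
Proof. by case: s => //= x s; rewrite /keyed; case kx: (key x) => /=. Qed.

Lemma last_unruns C Cs :
  last None (map key (unruns C Cs)) = last None (map key (last C Cs)).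
Proof.
rewrite /unruns; elim: Cs C => [|C' Cs IH] C /=; first by rewrite cats0.
by rewrite -IH map_cat last_cat /= key_blank.
Qed.

(** An empty first or last run means a wall at that end or no children at all; the default [None]
    then makes the boundary condition vacuous. *)
Lemma wall_ruleE s : wall_rule u (map key s) =
  [&& all increasing (runs s),
      (if last None (map key (last [::] (runs s))) is Some v
       then ~~ (u < v) else true)
    & (if head None (map key (head [::] (runs s))) is Some v
       then ~~ (v < u) else true)].
Proof.
rewrite /wall_rule compartments_runs all_map !wall_before_firstE head_runs.
congr [&& _, _ & _].
  by apply: eq_all => b /=; rewrite (sorted_pairwise ltn_trans).
rewrite -[s in rev (map key s)]runsK (runs_cons s) /= -last_unruns.
by case: (lastP (map key _)) => // l x; rewrite rev_rcons last_rcons.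
Qed.

Lemma wall_rule_walls_of_blocks bs :
  all (fun b => is_block (map key b)) bs ->
  wall_rule u (map key (walls_of_blocks bs)).
Proof.
move=> kbs; rewrite wall_ruleE; apply/and3P; split.
- have inc0 : increasing [::] by [].
  elim: bs kbs => //= b bs IH /andP[/increasing_block ib kbs].
  have ia : increasing (filter above b) := increasing_cat_below_above inc0 ib.
  have := IH kbs; rewrite runs_walls_of_blocks_cons.
  rewrite (runs_cons (walls_of_blocks bs)) /= ia => /andP[_ ->].
  rewrite andbT /=.
  (* The run after the first wall ends with the upper part of the next block, if there is one. *)
  case: bs {IH} kbs => [_|b' bs /andP[/increasing_block ib' _]] /=.
    exact: (increasing_cat_below_above ib inc0).
  rewrite runs_walls_of_blocks_cons; exact: increasing_cat_below_above.
(* The last run is the lower part of the last block, or empty if there are no blocks. *)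
- suff: all below (last [::] (runs (walls_of_blocks bs))).
    case: (lastP (last _ _)) => // C x; rewrite all_rcons => /andP[bx _].
    rewrite map_rcons last_rcons; move: bx; rewrite /below.
    by case: (key x) => // v; case: ltngtP.
  elim: {kbs} bs => //= b bs; rewrite runs_walls_of_blocks_cons.
  rewrite (runs_cons (walls_of_blocks bs)) /=.
  case: (behead _) => //= IH; rewrite all_cat IH andbT; exact: filter_all.
- case: bs kbs => // b bs _; rewrite runs_walls_of_blocks_cons /=.
  have := filter_all above b; case: (filter above b) => //= x C /andP[].
  by rewrite /above; case: (key x) => // v; case: ltngtP.
Qed.

(** Meant for the first run: a nonempty part below [u] would supply its head. *)
Lemma filter_above_run C : all keyed C -> increasing C -> avoiding C ->
  (if head None (map key C) is Some v then ~~ (v < u) else true) ->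
  filter above C = C.
Proof.
move=> kC iC aC hC; have sC := split_below_above kC iC aC.
case bC: (filter below C) sC => [//|y b] /= sC.
have: below y by have := filter_all below C; rewrite bC => /andP[].
by move: hC; rewrite -sC /= /below; case: (key y) => // v /negPf->.
Qed.

(** Meant for the last run: a nonempty part above [u] would supply its last key. *)
Lemma filter_below_run C : all keyed C -> increasing C -> avoiding C ->
  (if last None (map key C) is Some v then ~~ (u < v) else true) ->
  filter below C = C.
Proof.
move=> kC iC aC hC; have sC := split_below_above kC iC aC.
case: (lastP (filter above C)) (filter_all above C) sC => [|b y] /=.
  by rewrite cats0.
rewrite all_rcons => /andP[ay _] sC; move: hC; rewrite -sC map_cat map_rcons.
by rewrite last_cat last_rcons; move: ay; rewrite /above; case: (key y) => // v ->.
Qed.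

Lemma all_unruns (P : pred A) C Cs : P blank ->
  all P (unruns C Cs) = all (all P) (C :: Cs).
Proof.
by move=> Pb; rewrite /unruns all_cat all_flatten all_map /=;
   congr (_ && _); apply: eq_all => b /=; rewrite Pb.
Qed.

Lemma all_runs (P : pred A) s : P blank -> all (all P) (runs s) = all P s.
Proof. by move=> Pb; rewrite -[s in RHS]runsK all_unruns // -runs_cons. Qed.

Lemma avoid_blank : key blank != Some u. Proof. by rewrite key_blank. Qed.

Lemma blocks_of_wallsK s : wall_rule u (map key s) -> avoiding s ->
  walls_of_blocks (blocks_of_walls s) = s.
Proof.
rewrite wall_ruleE /avoiding -all_runs ?avoid_blank //.
have := all_keyed_runs s; rewrite /blocks_of_walls -[RHS]runsK.
rewrite (runs_cons s) [last _ _]/= [head _ (_ :: _)]/=.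
move: (head _ _) (behead _) => C Cs kCs /and3P[iCs lC hC] aCs.
have lastC : filter below (last C Cs) = last C Cs.
  by apply: filter_below_run lC; rewrite all_last.
have {lC hC} C_above : filter above C = C.
  move: kCs iCs aCs => /andP[kC _] /andP[iC _] /andP[aC _].
  exact: filter_above_run.
(* With the first run written as its upper part, the claim makes sense for every [C], so the
   induction can move on to runs that also have a lower part. *)
rewrite -[C in unruns C]C_above /walls_of_blocks /unruns.
move: kCs iCs aCs => /andP[_ kCs] /andP[_ iCs] /andP[_ aCs].
elim: Cs C {C_above} kCs iCs aCs lastC => [|C' Cs IH] C /=.
  (* Here [C] is the last run; it lies below [u], so its upper part is empty. *)
  by move=> _ _ _ <-; rewrite filter_above_below.
case/andP=> kC' kCs /andP[iC' iCs] /andP[aC' aCs] lC.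
rewrite wall_block_merge -catA IH //=.
rewrite -[C' in RHS](split_below_above kC' iC' aC').
by rewrite -!catA.
Qed.

Lemma blocks_of_walls_blocks s : wall_rule u (map key s) ->
  all (fun b => is_block (map key b)) (blocks_of_walls s).
Proof.
rewrite wall_ruleE => /and3P[]; have := all_keyed_runs s.
rewrite /blocks_of_walls (runs_cons s) /= => + + _ _.
move: (head _ _) (behead _) => C Cs /andP[kC kCs] /andP[iC iCs].
elim: Cs C {kC} iC kCs iCs => //= C' Cs IH C iC /andP[kC' kCs] /andP[iC' iCs].
rewrite IH // andbT is_block_fill //; last exact: increasing_cat_below_above.
by rewrite all_cat all_keyed_below all_keyed_above.
Qed.

(** * Predicates and sums carried across the local maps *)

Lemma all_walls_of_blocks (P : pred A) bs : P blank ->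
  all P (flatten bs) -> all P (walls_of_blocks bs).
Proof.
move=> Pb; rewrite !all_flatten all_map; apply: sub_all => b /= Pbs.
have Pf a : all P (filter a b).
  by rewrite all_filter; apply: sub_all Pbs => x /= ->; rewrite implybT.
by rewrite all_cat /= Pb !Pf.
Qed.

Lemma all_blocks_of_walls (P : pred A) s : P blank ->
  all P s -> all P (flatten (blocks_of_walls s)).
Proof.
move=> Pb; rewrite -all_runs // /blocks_of_walls (runs_cons s) /= => /andP[].
move: (head _ _) (behead _) => C Cs.
elim: Cs C => //= C' Cs IH C PC /andP[PC' PCs].
rewrite all_cat IH // andbT /merge_runs.
have Pf a b : all P b -> all P (filter a b).
  by move=> Pb'; rewrite all_filter; apply: sub_all Pb' => x /= ->; rewrite implybT.
by rewrite /fill; case: nilp => /=; rewrite ?Pb // all_cat !Pf.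
Qed.

(** Each block brings one wall, and each keyed child lies in exactly one of the two filters.
    Suitable [F] count half-edges or labels. *)
Lemma sum_walls_of_blocks (F : A -> nat) bs : avoiding (flatten bs) ->
  \sum_(x <- walls_of_blocks bs) F x =
  size bs * F blank + \sum_(x <- flatten bs | keyed x) F x.
Proof.
elim: bs => [|b bs IH]; first by rewrite !big_nil.
rewrite /avoiding /walls_of_blocks /= all_cat => /andP[ab abs].
rewrite !big_cat big_cons /= IH // mulSn -/(walls_of_blocks bs).
suff -> : \sum_(x <- b | keyed x) F x =
   \sum_(x <- filter above b) F x + \sum_(x <- filter below b) F x by ring.
elim: b ab {abs} => [|x b IHb] /=; first by rewrite !big_nil.
case/andP=> nx /IHb{}IHb; rewrite big_cons IHb /keyed /above /below.
move: nx; case kx: (key x) => [v|] //= nv.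
case: ltngtP nv => [|| ->]; rewrite ?eqxx //= => _ _; rewrite big_cons; ring.
Qed.

End BlocksAndWalls.

(** Only keys matter to the construction, so recursion into the subtrees may be done before or after
    it. *)
Lemma map_walls_of_blocks (A B : Type) (keyA : A -> option nat)
    (keyB : B -> option nat) blankA blankB (u : nat) (g : A -> B) bs :
    (forall x, keyB (g x) = keyA x) -> g blankA = blankB ->
  [seq g x | x <- walls_of_blocks keyA blankA u bs] =
  walls_of_blocks keyB blankB u [seq [seq g x | x <- b] | b <- bs].
Proof.
move=> keyg gblank; rewrite /walls_of_blocks map_flatten -!map_comp.
congr flatten; apply: eq_map => b /=.
rewrite /wall_block map_cat /= gblank !filter_map.
by congr (map g _ ++ blankB :: map g _); apply: eq_filter => x /=;
   rewrite /above /below keyg.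
Qed.

(** * Ordered trees *)

Section TreeEq.
Variable D : eqType.

(** The encoding yields decidable equality on trees, hence membership among children; the node tag
    tells vertices from blanks. *)
Fixpoint encode_otree (t : otree D) : GenTree.tree D :=
  if t is Vertex d cs then
    GenTree.Node 0 (GenTree.Leaf d :: map encode_otree cs)
  else GenTree.Node 1 [::].

Fixpoint decode_otree (t : GenTree.tree D) : otree D :=
  if t is GenTree.Node 0 (GenTree.Leaf d :: ts) then
    Vertex d (map decode_otree ts)
  else Blank.

Lemma encode_otreeK : cancel encode_otree decode_otree.
Proof.
rewrite /cancel; fix IH 1; case=> [|d cs] //=; congr Vertex.
by elim: cs => //= c cs ->; rewrite IH.
Qed.

End TreeEq.

Definition eq_otree (D : eqType) (t t' : otree D) : bool :=
  encode_otree t == encode_otree t'.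

Lemma eq_otreeP (D : eqType) : Equality.axiom (@eq_otree D).
Proof. exact: inj_eqAxiom (can_inj (@encode_otreeK D)). Qed.

HB.instance Definition _ (D : eqType) :=
  hasDecEq.Build (otree D) (@eq_otreeP D).

(** Children are nested inside a [seq], so the induction hypothesis for all of them is obtained by
    an inner induction on the list. *)
Lemma otree_ind_in (D : eqType) (P : otree D -> Prop) :
  P Blank -> (forall d cs, {in cs, forall c, P c} -> P (Vertex d cs)) ->
  forall t, P t.
Proof.
move=> PB PV; fix IH 1; case=> [|d cs]; [exact: PB | apply: PV].
elim: cs => [x|c cs IHcs x]; first by clear IH.
by rewrite inE => /orP[/eqP-> | xcs]; [exact: IH | exact: IHcs].
Qed.

Section Vertices.
Variable D : eqType.
Implicit Type t : otree D.

Lemma all_vertices (P : pred (nat * otree D)) l d cs :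
  all P (vertices l (Vertex d cs)) =
  P (l, Vertex d cs) && all (fun c => all P (vertices l.+1 c)) cs.
Proof. by rewrite /= all_flatten all_map. Qed.

(** The starting level only shifts the first components. Hence [labels] and [num_blanks], which
    start at level 0, can be computed from the children at level 1. *)
Lemma vertices_trees l l' t :
  [seq v.2 | v <- vertices l t] = [seq v.2 | v <- vertices l' t].
Proof.
elim/otree_ind_in: t l l' => // d cs IH l l' /=; congr cons.
rewrite !map_flatten -!map_comp; congr flatten.
by apply/eq_in_map => c /IH; apply.
Qed.

Lemma labels_Vertex d (cs : seq (otree D)) :
  labels (Vertex d cs) = d :: flatten (map (@labels D) cs).
Proof.
have labelsE l t : labels t = pmap (@label D) [seq v.2 | v <- vertices l t].
  rewrite (vertices_trees l 0) /labels.
  by elim: (vertices 0 t) => //= v s ->.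
rewrite (labelsE 0) [vertices _ _]/= map_cons map_flatten /= -!map_comp; congr cons.
elim: cs => //= c cs IH; rewrite pmap_cat -labelsE; congr cat; exact: IH.
Qed.

Lemma num_blanks_Vertex d (cs : seq (otree D)) :
  num_blanks (Vertex d cs) = \sum_(c <- cs) num_blanks c.
Proof.
have nbE l t : num_blanks t = count (predC (@labeled D)) [seq v.2 | v <- vertices l t].
  by rewrite (vertices_trees l 0) /num_blanks count_map.
rewrite (nbE 0) [vertices _ _]/= map_cons map_flatten /=.
rewrite -!map_comp count_flatten -map_comp sumnE big_map.
by apply: eq_bigr => c _; rewrite /= -nbE.
Qed.

Lemma count_labels_Vertex p d (cs : seq (otree D)) :
  count p (labels (Vertex d cs)) = p d + \sum_(c <- cs) count p (labels c).
Proof. by rewrite labels_Vertex /= count_flatten -map_comp sumnE big_map. Qed.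

End Vertices.

Lemma vertices_map_otree (D E : Type) (f : D -> E) l t :
  vertices l (map_otree f t) = [seq (v.1, map_otree f v.2) | v <- vertices l t].
Proof.
move: l t; fix IH 2 => l [|d cs] //=; congr cons.
by elim: cs => //= c cs ->; rewrite map_cat IH.
Qed.

(** * Multiplicities: no even-level vertex has a child with its own label *)

Lemma count_multiset (n : nat) (k : nat -> nat) u :
  count_mem u (multiset n k) = (0 < u <= n) * k u.
Proof.
have -> : (0 < u <= n) = (u \in iota 1 n) by rewrite mem_iota add1n ltnS.
rewrite /multiset; elim: (iota 1 n) (iota_uniq 1 n) => //= i s IH /andP[nis us].
rewrite count_cat count_nseq IH //= [i == u]eq_sym.
by rewrite in_cons; case: eqP => [->|_] /=; rewrite ?(negPf nis) ?addn0.
Qed.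

Definition avoids_label (t : otree nat) : bool :=
  if t is Vertex u cs then avoiding (@label nat) u cs else true.

Definition odd_vertex_rule (k : nat -> nat) (v : nat * otree nat) : bool :=
  if v.2 is Vertex i cs then
    odd v.1 ==> (size cs == k i - 1) && all (fun c => label c == Some i) cs
  else true.

Lemma count_label_gt0 (t : otree nat) u :
  label t == Some u -> 0 < count_mem u (labels t).
Proof. by case: t => // d cs /eqP[->]; rewrite count_labels_Vertex /= eqxx. Qed.

Lemma sum_rem (A : eqType) (F : A -> nat) x s : x \in s ->
  \sum_(y <- s) F y = F x + \sum_(y <- rem x s) F y.
Proof. by move=> xs; rewrite (perm_big _ (perm_to_rem xs)) big_cons. Qed.

Lemma count_child_le p u (cs : seq (otree nat)) c : c \in cs ->
  count p (labels c) <= count p (labels (Vertex u cs)).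
Proof.
move=> ccs; rewrite count_labels_Vertex (sum_rem _ ccs) /=.
by rewrite addnCA leq_addr.
Qed.

(* An odd-level vertex labeled [i] and its [k i - 1] children exhaust the
   occurrences of [i], so that no grandchild is labeled [i]. *)
Lemma grandchildren_avoid (k : nat -> nat) i cs c :
    size cs = k i - 1 -> all (fun c => label c == Some i) cs -> c \in cs ->
  count_mem i (labels (Vertex i cs)) <= k i -> avoids_label c.
Proof.
move=> size_cs lcs ccs; have := allP lcs c ccs.
case: c ccs => // j gs ccs /eqP[eji].
(* A grandchild [g] labeled [i] would force [k i + 1] occurrences: one at the top, two in the
   subtree of [c], and one in each of the other [k i - 2] children. *)
subst j; rewrite [avoids_label _]/= /avoiding; apply: contraTT => /allPn[g ggs].
rewrite negbK => lg; rewrite -ltnNge.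
have pii : (pred1 i) i by rewrite /= eqxx.
rewrite count_labels_Vertex (sum_rem _ ccs) pii.
have size_rem_le : size (rem (Vertex i gs) cs) <=
    \sum_(x <- rem (Vertex i gs) cs) count_mem i (labels x).
  rewrite -sum1_size big_seq [leqRHS]big_seq; apply: leq_sum => x /mem_rem xcs.
  by apply: count_label_gt0; apply: (allP lcs).
have gt1 : 1 < count_mem i (labels (Vertex i gs)).
  rewrite count_labels_Vertex (sum_rem _ ggs) pii.
  by rewrite add1n ltnS ltn_addr // count_label_gt0.
(* Since [c] is in [cs], the truncated [k i - 1] is positive, so [k i] is at least 2. *)
move: size_rem_le; rewrite size_rem // size_cs; have: 0 < size cs by case: (cs) ccs.
rewrite size_cs; move: gt1 {pii}.
by move: (count_mem i _) (\sum_(_ <- _) _) => x y; lia.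
Qed.

(** Avoidance at an even-level vertex comes from the rule at its odd-level parent; the last
    hypothesis passes it down, and [grandchildren_avoid] provides it. *)
Lemma avoiding_below (k : nat -> nat) l t :
    all (odd_vertex_rule k) (vertices l t) ->
    (forall u, count_mem u (labels t) <= k u) -> (~~ odd l -> avoids_label t) ->
  all (fun v => ~~ odd v.1 ==> avoids_label v.2) (vertices l t).
Proof.
elim/otree_ind_in: t l => [|i cs IH] l; first by move=> _ _ _; rewrite /= implybT.
rewrite !all_vertices /= => /andP[rule_t rule_cs] count_t avoid_t.
apply/andP; split; first by apply/implyP.
apply/allP => c ccs; apply: IH => //; first exact: (allP rule_cs).
  by move=> u; apply: leq_trans (count_t u); apply: count_child_le.
rewrite /= negbK => odd_l; move: rule_t; rewrite /odd_vertex_rule /= odd_l /=.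
by case/andP=> /eqP size_cs lcs; exact: grandchildren_avoid lcs ccs (count_t i).
Qed.

(** The root is treated apart: label 0 occurs only there, and [k 0] is arbitrary, so the bound by
    [k] is used only on the subtrees of its children. *)
Lemma avoiding_tree n k t :
    labeled_by n k t -> label t == Some 0 -> odd_level_rule k t ->
  all (fun v => ~~ odd v.1 ==> avoids_label v.2) (vertices 0 t).
Proof.
case: t => // d cs; rewrite /labeled_by labels_Vertex => + /eqP[d0]; subst d.
rewrite perm_cons => /permP count_cs; rewrite /odd_level_rule !all_vertices /=.
move=> rule_cs.
have count_le c p : c \in cs -> count p (labels c) <= count p (multiset n k).
  move=> ccs; rewrite -count_cs count_flatten -map_comp sumnE big_map.
  by rewrite (sum_rem _ ccs) leq_addr.
apply/andP; split.
  apply/allP => c ccs; apply/negP => /count_label_gt0.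
  by have := count_le c (pred1 0) ccs; rewrite count_multiset /= leqn0 => /eqP->.
apply/allP => c ccs; apply: (@avoiding_below k) => //; first exact: (allP rule_cs).
move=> u; apply: leq_trans (count_le _ _ ccs) _.
by rewrite count_multiset; case: andP => _ //; rewrite mul1n.
Qed.

(** * Both tree families described vertex by vertex *)

Definition dlabel (t : divided_tree) : option nat := label (underlying t).

(** The conditions of [BT] at a single vertex, together with the avoidance implied by the
    multiplicities; in this form they are inherited by subtrees at any level. *)
Definition divided_rule (k : nat -> nat) (v : nat * divided_tree) : bool :=
  (labeled v.2 || odd v.1) &&
  (if v.2 is Vertex d cs then
     if odd v.1 then
       [&& d.2 == [::], size cs == k d.1 - 1
         & all (fun c => dlabel c == Some d.1) cs]
     else divided_into_blocks d.2 [seq dlabel c | c <- cs]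
          && avoiding dlabel d.1 cs
   else true).

(* Half-edges are placed at odd level only, so the odd-level rule may be checked
   without deleting them. *)
Definition half_edge_rule (k : nat -> nat) (v : nat * otree nat) : bool :=
  (labeled v.2 || odd v.1) &&
  (if v.2 is Vertex u cs then
     if odd v.1 then
       (size cs == k u - 1) && all (fun c => label c == Some u) cs
     else wall_rule u [seq label c | c <- cs] && avoiding (@label nat) u cs
   else true).

Definition block_count l (t : divided_tree) : nat :=
  sumn [seq size (block_sizes v.2) | v <- vertices l t & ~~ odd v.1].

Lemma labeled_underlying t : labeled (underlying t) = labeled t.
Proof. by case: t. Qed.

Lemma BT_rule n k m t : BT n k m t =
  [&& labeled_by n k (underlying t), label (underlying t) == Some 0,
      all (divided_rule k) (vertices 0 t) & block_count 0 t == m].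
Proof.
rewrite /BT /block_count; apply/idP/idP.
  case/and5P=> lab blanks root rule /andP[/allP blocks ->].
  rewrite lab root andbT /=; apply/allP => v vt.
  have := avoiding_tree lab root rule; move: blanks rule (blocks v vt).
  rewrite /blanks_at_odd_level /odd_level_rule /underlying vertices_map_otree.
  rewrite !all_map => /allP/(_ v vt)/= + /allP/(_ v vt)/= + + /allP/(_ v vt)/=.
  rewrite labeled_underlying /divided_rule => ->; case: v {vt} => l [|d cs] //=.
  rewrite size_map /avoiding !all_map.
  by case: odd => /= [/andP[? ?] ? _|_ ? ?]; [apply/and3P | apply/andP].
case/and4P=> lab root /allP rule count_m.
apply/and5P; split=> //; last (apply/andP; split=> //);
  rewrite /blanks_at_odd_level /odd_level_rule /underlying ?vertices_map_otree
          ?all_map; apply/allP => -[l t'] /rule/andP[lt'] //=.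
- by rewrite labeled_underlying.
- case: t' {lt'} => //= d cs; rewrite size_map all_map.
  by case: odd => //= /and3P[_ -> ->].
- case: t' {lt'} => //= d cs; case: odd => [/and3P[]|/andP[]] //.
Qed.

Lemma label_strip t : label (strip t) = label t.
Proof. by case: t. Qed.

Lemma labeled_strip t : labeled (strip t) = labeled t.
Proof. by case: t. Qed.

Lemma labels_strip t : labels (strip t) = labels t.
Proof.
elim/otree_ind_in: t => // d cs IH; rewrite [strip _]/= !labels_Vertex.
congr cons; elim: cs IH => // c cs IHcs IH.
have {}IHcs : flatten [seq labels c | c <- [seq strip c | c <- cs] & labeled c] =
    flatten [seq labels c | c <- cs].
  by apply: IHcs => x xcs; apply: IH; rewrite in_cons xcs orbT.
rewrite [RHS]/= -IHcs -(IH c (mem_head _ _)) [map strip _]/= /=.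
by rewrite labeled_strip; case: c {IH IHcs}.
Qed.

Lemma labeled_vertices_strip l t : labeled t ->
  all (fun v => labeled v.2) (vertices l (strip t)).
Proof.
elim/otree_ind_in: t l => // d cs IH l _; rewrite [strip _]/= all_vertices /=.
apply/allP => c; rewrite mem_filter => /andP[lc /mapP[c' c'cs ec]]; subst c.
by apply: IH => //; rewrite -labeled_strip.
Qed.

(** Blanks sit at odd level, so an odd-level vertex has no blank child and keeps all its
    children. *)
Lemma odd_rule_strip k l t :
    all (fun v => labeled v.2 || odd v.1) (vertices l t) ->
  all (odd_vertex_rule k) (vertices l (strip t)) =
  all (odd_vertex_rule k) (vertices l t).
Proof.
elim/otree_ind_in: t l => // d cs IH l; rewrite [strip _]/= !all_vertices /=.
move=> blanks; congr (_ && _).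
  rewrite /odd_vertex_rule /=; case oddl: (odd l) => //=.
  suff /all_filterP-> : all (@labeled nat) [seq strip c | c <- cs].
    rewrite size_map all_map; congr (_ && _).
    by apply: eq_all => c /=; rewrite label_strip.
  rewrite all_map; apply/allP => c /(allP blanks) /=; rewrite labeled_strip.
  by case: c => //=; rewrite oddl.
rewrite all_filter all_map; apply: eq_in_all => c ccs /=.
rewrite IH //; last exact: (allP blanks).
by rewrite labeled_strip; case: (c).
Qed.

(** Deleting half-edges changes neither the labels nor the odd-level rule, so the conditions on
    [strip t] transfer to [t]; avoidance then follows from [avoiding_tree]. *)
Lemma Tstar_rule n k m t : Tstar n k m t =
  [&& labeled_by n k t, label t == Some 0,
      all (half_edge_rule k) (vertices 0 t) & num_blanks t == m].
Proof.
rewrite /Tstar /T /labeled_by label_strip labels_strip; apply/idP/idP.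
  case/and4P=> /and4P[_ lab root rule] blanks -> walls; rewrite lab root andbT /=.
  move: rule; rewrite /odd_level_rule odd_rule_strip // => rule.
  have avoid := avoiding_tree lab root rule; apply/allP => v vt.
  move/allP/(_ v vt): blanks; move/allP/(_ v vt): rule.
  move/allP/(_ v vt): walls; move/allP/(_ v vt): avoid.
  rewrite /half_edge_rule /odd_vertex_rule => + + + ->.
  by case: v {vt} => l [|d cs] //=; case: odd => //= -> ->.
case/and4P=> lab root /allP rule ->.
have blanks : blanks_at_odd_level t by apply/allP => v /rule /andP[].
rewrite lab root blanks /=; rewrite -andbA; apply/and3P; split.
- by apply: labeled_vertices_strip; case: (t) root.
- rewrite /odd_level_rule odd_rule_strip //; apply/allP => -[l t'] /rule /andP[_] /=.
  by case: t' => // d cs; rewrite /odd_vertex_rule /=; case: odd.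
- apply/allP => -[l t'] /rule /andP[_] /=.
  by case: t' => // d cs; case: odd => //= /andP[].
Qed.

(** * The bijection *)

(** The level is carried along for its parity; [reshape] recovers the blocks from their recorded
    sizes. *)
Fixpoint insert_walls l (t : divided_tree) : otree nat :=
  if t is Vertex d cs then
    let cs' := [seq insert_walls l.+1 c | c <- cs] in
    Vertex d.1 (if odd l then cs' else
                walls_of_blocks (@label nat) Blank d.1 (reshape d.2 cs'))
  else Blank.

Fixpoint divide l (t : otree nat) : divided_tree :=
  if t is Vertex u cs then
    let cs' := [seq divide l.+1 c | c <- cs] in
    if odd l then Vertex (u, [::]) cs' else
    let bs := blocks_of_walls dlabel Blank u cs' in
    Vertex (u, shape bs) (flatten bs)
  else Blank.

Lemma label_insert_walls l t : label (insert_walls l t) = dlabel t.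
Proof. by case: t. Qed.

Lemma dlabel_divide l t : dlabel (divide l t) = label t.
Proof. by case: t => //= u cs; case: odd. Qed.

Lemma dlabel_Blank t : dlabel t = None -> t = Blank. Proof. by case: t. Qed.
Lemma label_Blank (t : otree nat) : label t = None -> t = Blank. Proof. by case: t. Qed.

Lemma divided_into_blocksE (A : Type) (key : A -> option nat) sz s :
  divided_into_blocks sz [seq key x | x <- s] =
  (sumn sz == size s) && all (fun b => is_block [seq key x | x <- b]) (reshape sz s).
Proof. by rewrite /divided_into_blocks size_map -map_reshape all_map. Qed.

Lemma divided_into_blocks_flatten (A : Type) (key : A -> option nat) bs :
  all (fun b => is_block [seq key x | x <- b]) bs ->
  divided_into_blocks (shape bs) [seq key x | x <- flatten bs].
Proof. by move=> kbs; rewrite divided_into_blocksE size_flatten eqxx flattenK. Qed.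

Lemma insert_wallsK k l t :
  all (divided_rule k) (vertices l t) -> divide l (insert_walls l t) = t.
Proof.
elim/otree_ind_in: t l => // -[u sz] cs IH l.
rewrite all_vertices => /andP[rule_t rule_cs].
have csK : [seq divide l.+1 c | c <- [seq insert_walls l.+1 c | c <- cs]] = cs.
  by rewrite -map_comp map_id_in // => c ccs /=; rewrite IH // (allP rule_cs).
move: rule_t; rewrite /divided_rule /=; case: odd => [/and3P[/eqP-> _ _]|].
  by rewrite csK.
rewrite divided_into_blocksE => /andP[/andP[/eqP size_cs kcs] acs].
rewrite (map_walls_of_blocks (keyB := dlabel) (blankB := Blank)) //;
  last exact: dlabel_divide.
rewrite map_reshape csK walls_of_blocksK //; try exact: dlabel_Blank.
  (* The sizes sum to the number of children, so cutting is exact and both [sz] and [cs] are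
     recovered. *)
  by rewrite reshapeKl ?size_cs // reshapeKr ?size_cs.
by rewrite /avoiding -all_flatten reshapeKr ?size_cs.
Qed.

Lemma divideK k l t :
  all (half_edge_rule k) (vertices l t) -> insert_walls l (divide l t) = t.
Proof.
elim/otree_ind_in: t l => // u cs IH l.
rewrite all_vertices => /andP[rule_t rule_cs].
have csK : [seq insert_walls l.+1 c | c <- [seq divide l.+1 c | c <- cs]] = cs.
  by rewrite -map_comp map_id_in // => c ccs /=; rewrite IH // (allP rule_cs).
move: rule_t; rewrite /half_edge_rule /=.
case oddl: (odd l); [move=> _ | case/andP=> wcs acs]; rewrite /=.
  by rewrite oddl csK.
rewrite oddl -map_reshape flattenK.
rewrite -(map_walls_of_blocks (keyA := dlabel) (blankA := Blank)) //;
  last exact: label_insert_walls.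
have keysE : [seq dlabel c | c <- [seq divide l.+1 c | c <- cs]] =
    [seq label c | c <- cs].
  by rewrite -map_comp; apply: eq_map => c; exact: dlabel_divide.
rewrite blocks_of_wallsK ?csK ?keysE //; first exact: dlabel_Blank.
by rewrite /avoiding all_map; apply: sub_all acs => c /=; rewrite dlabel_divide.
Qed.

Lemma half_edge_rule_insert_walls k l t :
  all (divided_rule k) (vertices l t) ->
  all (half_edge_rule k) (vertices l (insert_walls l t)).
Proof.
elim/otree_ind_in: t l => [|[u sz] cs IH] l; first by [].
rewrite [insert_walls _ _]/= !all_vertices => /andP[rule_t rule_cs].
have wf_cs : all (fun c => all (half_edge_rule k) (vertices l.+1 c))
    [seq insert_walls l.+1 c | c <- cs].
  by rewrite all_map; apply/allP => c ccs /=; rewrite IH // (allP rule_cs).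
move: rule_t; rewrite /divided_rule /half_edge_rule [_ || _]/= /=.
case oddl: (odd l) => /=; first (case/and3P=> _ size_cs lcs).
  rewrite size_map size_cs all_map wf_cs andbT /=; apply: sub_all lcs => c /=.
  by rewrite label_insert_walls.
rewrite divided_into_blocksE => /andP[/andP[/eqP size_cs kcs] acs].
have keysE : [seq dlabel c | c <- cs] =
    [seq label c | c <- [seq insert_walls l.+1 c | c <- cs]].
  by rewrite -map_comp; apply: eq_map => c; rewrite /= label_insert_walls.
apply/andP; split; last first.
  apply: all_walls_of_blocks; rewrite ?reshapeKr ?size_map ?size_cs //=.
  (* A new wall lies at level [l.+1], which is odd. *)
  by rewrite /half_edge_rule /= oddl.
apply/andP; split.
  apply: wall_rule_walls_of_blocks => //; first exact: label_Blank.
  rewrite -map_reshape all_map; apply: sub_all kcs => b /=.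
  rewrite -map_comp; congr is_block.
  by apply: eq_map => c /=; rewrite label_insert_walls.
apply: all_walls_of_blocks => //; rewrite reshapeKr ?size_map ?size_cs // all_map.
by apply: sub_all acs => c /=; rewrite label_insert_walls.
Qed.

Lemma divided_rule_divide k l t :
  all (half_edge_rule k) (vertices l t) ->
  all (divided_rule k) (vertices l (divide l t)).
Proof.
elim/otree_ind_in: t l => [|u cs IH] l; first by [].
rewrite [divide _ _]/= all_vertices => /andP[rule_t rule_cs].
have wf_cs : all (fun c => all (divided_rule k) (vertices l.+1 c))
    [seq divide l.+1 c | c <- cs].
  by rewrite all_map; apply/allP => c ccs /=; rewrite IH // (allP rule_cs).
move: rule_t; rewrite /half_edge_rule /=.
case oddl: (odd l); [case/andP=> size_cs lcs | case/andP=> wcs acs];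
  rewrite all_vertices /divided_rule /= oddl /=.
  rewrite size_map size_cs all_map wf_cs andbT /=; apply: sub_all lcs => c /=.
  by rewrite dlabel_divide.
have keysE : [seq dlabel c | c <- [seq divide l.+1 c | c <- cs]] =
    [seq label c | c <- cs].
  by rewrite -map_comp; apply: eq_map => c; exact: dlabel_divide.
apply/andP; split; last first.
  apply: all_blocks_of_walls; rewrite //=; first exact: dlabel_Blank.
  by rewrite oddl.
apply/andP; split.
  apply: divided_into_blocks_flatten; apply: blocks_of_walls_blocks; rewrite ?keysE //.
  exact: dlabel_Blank.
apply: all_blocks_of_walls => //; first exact: dlabel_Blank.
rewrite all_map.
by apply: sub_all acs => c /=; rewrite dlabel_divide.
Qed.

(** * Counting half-edges and labels *)

Lemma block_count_Vertex l d cs : block_count l (Vertex d cs) =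
  (if odd l then 0 else size d.2) + \sum_(c <- cs) block_count l.+1 c.
Proof.
rewrite /block_count /= filter_flatten.
have sumE : sumn [seq size (block_sizes v.2) |
      v <- flatten [seq [seq v <- x | ~~ odd v.1]
                   | x <- [seq vertices l.+1 c | c <- cs]]] =
    \sum_(c <- cs) block_count l.+1 c.
  by rewrite map_flatten sumn_flatten -!map_comp sumnE big_map.
by case: (odd l); rewrite /= sumE.
Qed.

Lemma sum_insert_walls k (F : otree nat -> nat) l u sz cs :
    divided_rule k (l, Vertex (u, sz) cs) -> ~~ odd l ->
  \sum_(c <- walls_of_blocks (@label nat) Blank u
               (reshape sz [seq insert_walls l.+1 c | c <- cs])) F c =
  size sz * F Blank + \sum_(c <- cs | labeled c) F (insert_walls l.+1 c).
Proof.
rewrite /divided_rule /= => + /negPf oddl; rewrite oddl divided_into_blocksE.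
case/andP=> /andP[/eqP size_cs _] acs.
rewrite sum_walls_of_blocks ?reshapeKr ?size_map ?size_cs //.
  by rewrite size_reshape big_map; congr (_ + _); apply: eq_bigl; case.
by rewrite /avoiding all_map; apply: sub_all acs => c /=; rewrite label_insert_walls.
Qed.

(** Every block leaves one wall, and a blank block leaves nothing else. A bare blank is excluded,
    being one half-edge with no block. *)
Lemma num_blanks_insert_walls k l t :
    all (divided_rule k) (vertices l t) -> labeled t ->
  num_blanks (insert_walls l t) = block_count l t.
Proof.
elim/otree_ind_in: t l => // -[u sz] cs IH l; rewrite all_vertices.
move=> /andP[rule_t /allP rule_cs] _.
rewrite num_blanks_Vertex block_count_Vertex; case oddl: (odd l).
  rewrite big_map big_seq [RHS]big_seq; apply: eq_bigr => c ccs.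
  apply: IH => //; first exact: rule_cs.
  move: rule_t; rewrite /divided_rule /= oddl => /and3P[_ _ /allP/(_ c ccs)].
  by case: c {ccs}.
rewrite (sum_insert_walls _ rule_t) ?oddl // muln1; congr (_ + _).
rewrite big_mkcond big_seq [RHS]big_seq; apply: eq_bigr => c ccs.
case: ifP => [lc|]; [exact: IH (rule_cs c ccs) lc | case: (c) => // _].
by rewrite /block_count /= oddl.
Qed.

Lemma count_labels_insert_walls k p l t :
    all (divided_rule k) (vertices l t) ->
  count p (labels (insert_walls l t)) = count p (labels (underlying t)).
Proof.
elim/otree_ind_in: t l => // -[u sz] cs IH l; rewrite all_vertices.
move=> /andP[rule_t /allP rule_cs].
rewrite [underlying _]/= [insert_walls _ _]/= !count_labels_Vertex big_map; congr (_ + _).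
case oddl: (odd l).
  rewrite big_map big_seq [RHS]big_seq; apply: eq_bigr => c ccs.
  exact: IH (rule_cs c ccs).
rewrite (sum_insert_walls _ rule_t) ?oddl // muln0 add0n.
rewrite big_mkcond big_seq [RHS]big_seq; apply: eq_bigr => c ccs.
by case: ifP => [lc|]; [exact: IH (rule_cs c ccs) | case: (c)].
Qed.

Lemma Tstar_insert_walls n k m t : BT n k m t -> Tstar n k m (insert_walls 0 t).
Proof.
rewrite BT_rule Tstar_rule => /and4P[lab root rule blocks].
rewrite label_insert_walls root half_edge_rule_insert_walls //=.
rewrite (num_blanks_insert_walls rule) ?blocks ?andbT //; last by case: (t) root.
apply: perm_trans lab; apply/permP => p.
exact: count_labels_insert_walls rule.
Qed.

Lemma BT_divide n k m t : Tstar n k m t -> BT n k m (divide 0 t).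
Proof.
rewrite BT_rule Tstar_rule => /and4P[lab root rule blanks].
have rule' := divided_rule_divide rule.
rewrite -/(dlabel _) dlabel_divide root rule' /=.
(* Both counts for [divide 0 t] come from those for [insert_walls], which maps it back to [t]. *)
rewrite -(num_blanks_insert_walls rule') ?(divideK rule) ?blanks ?andbT;
  last by case: (t) root.
apply: perm_trans lab; apply/permP => p.
by rewrite -(count_labels_insert_walls p rule') (divideK rule).
Qed.

Theorem theorem2p2 (n : nat) (k : nat -> nat) (m : nat)
    (hn : 1 <= n) (hk : forall i : nat, 1 <= i <= n -> 1 <= k i) :
  exists psi : {t : divided_tree | BT n k m t} -> {t : otree nat | Tstar n k m t},
    bijective psi.
Proof.
exists (fun t => exist (fun t => Tstar n k m t) _ (Tstar_insert_walls (valP t))).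
exists (fun t => exist (fun t => BT n k m t) _ (BT_divide (valP t))) => -[t tP]; apply: val_inj => /=.
  by move: tP; rewrite BT_rule => /and4P[_ _ /insert_wallsK].
by move: tP; rewrite Tstar_rule => /and4P[_ _ /divideK].
Qed.
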